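(* Let $\mathbf{k}$ be a field of characteristic zero and $V$ a finite-dimensional $\mathbf{k}$-vector space, $X=V$ regarded as an affine space, $\mathcal{O}(X)=\mathrm{Sym}(V^* )$. Let $\gamma=\sum_{i,j}\gamma^{ij}\partial_i\wedge\partial_j$ be a Poisson structure on $X$ whose coefficients $\gamma^{ij}$ are polynomials of degree $\le2$, and let $*_\hbar$ be the canonical star product on $\mathrm{Sym}(V^* )[[\hbar]]$ associated with $\gamma$. Then the dense subspace $A_\gamma:=\mathrm{Sym}(V^* )\otimes\mathbf{k}[[\hbar]]$ of $\mathrm{Sym}(V^* )[[\hbar]]$ is closed under $*_\hbar$, and the algebra $A_\gamma$ over $\mathbf{k}[[\hbar]]$ is a semi-formal deformation of $\mathrm{Sym}(V^* )$, filtered by the free $\mathbf{k}[[\hbar]]$-modules of finite rank $\mathrm{Sym}^{\le n}(V^* )\otimes\mathbf{k}[[\hbar]]$. The associated graded algebra of this filtration coincides with the algebra $A_{\gamma_2}$ obtained in the same way from the purely quadratic part $\gamma_2$ of $\gamma$. If $\gamma$ is purely quadratic, then $*_\hbar$ is homogeneous of degree $0$ with respect to the grading of $\mathrm{Sym}(V^* )$, i.e. $\mathrm{Sym}^k(V^* )*_\hbar\mathrm{Sym}^l(V^* )\subset\mathrm{Sym}^{k+l}(V^* )\otimes\mathbf{k}[[\hbar]]$.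
   Context: **Star product.** With $\gamma^{ij}=-\gamma^{ji}$, the canonical star product on the affine space is Kontsevich's, $$f*_\hbar g=fg+\sum_{n\ge1}\hbar^n\sum_{\Gamma\in G_n}w_\Gamma B_{\Gamma,\gamma}(f,g).$$ Here $G_n$ is the finite set of (labelled) admissible graphs with vertices $1,\dots,n,L,R$, where each $k\in\{1,\dots,n\}$ has exactly two ordered outgoing edges $e_k^1,e_k^2$ to vertices different from $k$. The bidifferential operator is $$B_{\Gamma,\gamma}(f,g)=\sum_{I}\prod_{k=1}^n\Big(\prod_{e\to k}\partial_{I(e)}\Big)\gamma^{I(e_k^1)I(e_k^2)}\cdot\Big(\prod_{e\to L}\partial_{I(e)}\Big)f\cdot\Big(\prod_{e\to R}\partial_{I(e)}\Big)g,$$ the sum being over all maps $I$ from edges to coordinate indices. The weights $w_\Gamma\in\mathbf{k}$ form a fixed universal system (Kontsevich's weights, or another solution over $\mathbf{k}$ of the same universal quadratic equations) coming from a formality $L_\infty$-quasi-isomorphism extending the Hochschild–Kostant–Rosenberg map. For every Poisson structure $*_\hbar$ is associative, and $f*_\hbar g=fg+\hbar\{f,g\}+O(\hbar^2)$ with $\{f,g\}=\sum\gamma^{ij}\partial_if\,\partial_jg$. **Semi-formal deformation.** Let $R$ be a complete pro-Artin local ring with residue field $\mathbf{k}$ and $A$ a finitely generated associative $\mathbf{k}$-algebra. A semi-formal deformation of $A$ over $R$ is an $R$-algebra $\widehat{A}$ with an identification of $\mathbf{k}$-algebras $A\simeq\widehat{A}\otimes_R\mathbf{k}$, such that there exists an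 exhaustive increasing filtration of $\widehat{A}$ by finitely generated free $R$-modules $\widehat{A}_{\le n}$ ($n\ge0$), compatible with the product, admitting a splitting as a filtration of $R$-modules, and such that the Rees ring $\bigoplus_nA_{\le n}t^n\subset A[t]$ of the induced filtration of $A$ is finitely generated over $\mathbf{k}$. *)

(* Defs.v *)
(* MathComp, with multinomials for polynomials and mathcomp.classical.boolp for
   the choice structure on power series. *)
From HB Require Import structures.
From mathcomp Require Import all_boot all_order all_algebra.
From mathcomp Require Import boolp.
From mathcomp Require Import mpoly.

Set Implicit Arguments.
Unset Strict Implicit.
Unset Printing Implicit Defensive.

Import GRing.Theory.
Local Open Scope ring_scope.

(** * Formal power series in hbar *)

Record fps (M : Type) := Fps { fcoef :> nat -> M }.

Lemma fpsP (M : Type) (F G : fps M) : F =1 G -> F = G.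
Proof. by case: F G => [f] [g] /= /funext ->. Qed.

HB.instance Definition _ (M : Type) := gen_eqMixin (fps M).
HB.instance Definition _ (M : Type) := gen_choiceMixin (fps M).

Section FpsZmodule.
Variable M : zmodType.
Implicit Types F G H : fps M.

Definition fps_zero : fps M := Fps (fun=> 0).
Definition fps_opp F : fps M := Fps (fun n => - F n).
Definition fps_add F G : fps M := Fps (fun n => F n + G n).

Fact fps_addA : associative fps_add.
Proof. by move=> F G H; apply: fpsP => n /=; rewrite addrA. Qed.
Fact fps_addC : commutative fps_add.
Proof. by move=> F G; apply: fpsP => n /=; rewrite addrC. Qed.
Fact fps_add0 : left_id fps_zero fps_add.
Proof. by move=> F; apply: fpsP => n /=; rewrite add0r. Qed.
Fact fps_addN : left_inverse fps_zero fps_opp fps_add.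
Proof. by move=> F; apply: fpsP => n /=; rewrite addNr. Qed.

HB.instance Definition _ :=
  GRing.isZmodule.Build (fps M) fps_addA fps_addC fps_add0 fps_addN.

Definition fps_const (p : M) : fps M := Fps (fun n => if n is 0%N then p else 0).

End FpsZmodule.

Section FpsRing.
Variable R : comNzRingType.
Implicit Types F G H : fps R.

Definition fps_one : fps R := fps_const 1.
Definition fps_mul F G : fps R :=
  Fps (fun n => \sum_(i < n.+1) F i * G (n - i)%N).

Fact fps_mulC : commutative fps_mul.
Proof.
move=> F G; apply: fpsP => n /=.
rewrite (reindex_inj rev_ord_inj) /=; apply: eq_bigr => i _.
by rewrite subSS mulrC subKn // -ltnS.
Qed.

Fact fps_mulA : associative fps_mul.
Proof.
move=> F G H; apply: fpsP => n; rewrite (fps_mulC (fps_mul F G)) /=.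
pose t i j := F i * (G (n - i - j)%N * H j).
transitivity (\sum_(i < n.+1) \sum_(j < n.+1 | (j <= n - i)%N) t i j).
  apply: eq_bigr => /= i _; rewrite (big_ord_narrow_leq (leq_subr _ _)) /=.
  rewrite (reindex_inj rev_ord_inj) /= big_distrr /=; apply: eq_bigr => j _.
  by rewrite /t subSS subKn // -ltnS.
rewrite (exchange_big_dep predT) //=; apply: eq_bigr => j _.
transitivity (\sum_(i < n.+1 | (i <= n - j)%N) t i j).
  apply: eq_bigl => i; rewrite -ltnS -(ltnS i) -!subSn ?leq_ord //.
  by rewrite -subn_gt0 -(subn_gt0 i) -!subnDA addnC.
rewrite (big_ord_narrow_leq (leq_subr _ _)) mulrC big_distrl /=.
by apply: eq_bigr => i _; rewrite /t -!subnDA addnC mulrA.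
Qed.

Fact fps_mul1 : left_id fps_one fps_mul.
Proof.
move=> F; apply: fpsP => n /=; rewrite big_ord_recl /= mul1r subn0.
by rewrite big1 ?addr0 // => i _; rewrite mul0r.
Qed.

Fact fps_mulDl : left_distributive fps_mul +%R.
Proof.
move=> F G H; apply: fpsP => n /=; rewrite -big_split /=.
by apply: eq_bigr => i _; rewrite mulrDl.
Qed.

Fact fps_one_neq0 : fps_one != 0.
Proof.
apply/eqP => /(congr1 (fun F : fps R => F 0%N)) /= /eqP.
by rewrite oner_eq0.
Qed.

HB.instance Definition _ := GRing.Zmodule_isComNzRing.Build (fps R)
  fps_mulA fps_mulC fps_mul1 fps_mulDl fps_one_neq0.

Definition fps_residue F : R := F 0%N.

Fact fps_residue_zmod : zmod_morphism fps_residue.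
Proof. by []. Qed.
Fact fps_residue_monoid : monoid_morphism fps_residue.
Proof. by split=> // F G; rewrite /fps_residue /= big_ord1. Qed.

HB.instance Definition _ :=
  GRing.isZmodMorphism.Build (fps R) R fps_residue fps_residue_zmod.
HB.instance Definition _ :=
  GRing.isMonoidMorphism.Build (fps R) R fps_residue fps_residue_monoid.

End FpsRing.

Definition fps_scale (k : comNzRingType) (M : lmodType k)
    (a : fps k) (F : fps M) : fps M :=
  Fps (fun n => \sum_(i < n.+1) a i *: F (n - i)%N).

Definition fps_map (M N : Type) (f : M -> N) (F : fps M) : fps N :=
  Fps (fun n => f (F n)).

(* The image in M[[hbar]] of S (x) k[[hbar]], for S a subspace of M: finite sums
   of products of a scalar series and an element of S. *)
Definition fps_tensor (k : comNzRingType) (M : lmodType k) (S : M -> Prop)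
    (F : fps M) : Prop :=
  exists (m : nat) (a : 'I_m -> fps k) (p : 'I_m -> M),
    (forall i, S (p i)) /\ F = \sum_i fps_scale (a i) (fps_const (p i)).

(** * The star product

   V is k^d, through a choice of linear coordinates, so that Sym V^* is
   {mpoly k[d]}; a bivector field is the matrix of its coefficients. *)

Section Poisson.
Variables (k : fieldType) (d : nat).
Implicit Types (gamma : 'M[{mpoly k[d]}]_d) (f g h : {mpoly k[d]}).

Definition bracket gamma f g : {mpoly k[d]} :=
  \sum_i \sum_j gamma i j * f^`M(i) * g^`M(j).

Definition is_poisson gamma : Prop :=
  gamma^T = - gamma /\
  forall f g h, bracket gamma f (bracket gamma g h)
    + bracket gamma g (bracket gamma h f)
    + bracket gamma h (bracket gamma f g) = 0.

Definition quadratic_part gamma : 'M[{mpoly k[d]}]_d :=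
  map_mx (pihomog mdeg 2%N) gamma.

End Poisson.

(* The edge e_k^1 (resp. e_k^2) is (k, false) (resp. (k, true)) and a graph maps
   each edge to its target; inl j is the vertex j, inr false is L, inr true is R.
   Graphs with e_k^1 and e_k^2 parallel are kept: since gamma is antisymmetric,
   their operators vanish. *)
Definition loopless (n : nat) (E : {ffun 'I_n * bool -> 'I_n + bool}) : bool :=
  [forall e, E e != inl e.1].

Definition kgraph (n : nat) : Type :=
  {E : {ffun 'I_n * bool -> 'I_n + bool} | loopless E}.

Section StarProduct.
Variables (k : fieldType) (w : forall n, kgraph n -> k) (d : nat).
Variable gamma : 'M[{mpoly k[d]}]_d.

Definition in_derivs (n : nat) (Gam : kgraph n) (I : {ffun 'I_n * bool -> 'I_d})
    (v : 'I_n + bool) : 'X_{1..d} :=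
  (\sum_(e | val Gam e == v) U_(I e))%MM.

Definition graph_op (n : nat) (Gam : kgraph n) (f g : {mpoly k[d]}) :
    {mpoly k[d]} :=
  \sum_(I : {ffun 'I_n * bool -> 'I_d})
    (\prod_(v < n)
       (gamma (I (v, false)) (I (v, true)))^`M[in_derivs Gam I (inl v)])
    * f^`M[in_derivs Gam I (inr false)] * g^`M[in_derivs Gam I (inr true)].

Definition star_term (n : nat) (f g : {mpoly k[d]}) : {mpoly k[d]} :=
  if n is 0%N then f * g
  else \sum_(Gam : kgraph n) w Gam *: graph_op Gam f g.

(* The k[[hbar]]-bilinear, hbar-adically continuous extension. *)
Definition star (F G : fps {mpoly k[d]}) : fps {mpoly k[d]} :=
  Fps (fun N => \sum_(i < N.+1) \sum_(j < (N - i).+1)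
                  star_term (N - i - j) (F i) (G j)).

End StarProduct.

(* The properties for which the universal weights are used: they do not depend
   on the affine space nor on the Poisson structure, and always give an
   associative product deforming the commutative one along the bracket. *)
Definition universal_star_weights (k : fieldType)
    (w : forall n, kgraph n -> k) : Prop :=
  forall (d : nat) (gamma : 'M[{mpoly k[d]}]_d), is_poisson gamma ->
    associative (star w gamma) /\
    forall f g, star_term w gamma 1%N f g = bracket gamma f g.

(* [io] identifies the algebra [Ag] with the subspace Sym V^* (x) k[[hbar]] of
   k[V][[hbar]] endowed with the star product. The unit of [Ag] is not
   required to be the polynomial 1. *)
Record is_star_algebra (k : fieldType) (w : forall n, kgraph n -> k) (d : nat)
    (gamma : 'M[{mpoly k[d]}]_d) (Ag : algType (fps k))
    (io : Ag -> fps {mpoly k[d]}) : Prop := {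
  star_alg_linear : forall (c : fps k) (a b : Ag),
    io (c *: a + b) = fps_scale c (io a) + io b;
  star_alg_inj : injective io;
  star_alg_image : forall F, (exists a, io a = F) <-> fps_tensor (fun=> True) F;
  star_alg_mul : forall a b : Ag, io (a * b) = star w gamma (io a) (io b)
}.

(** * Semi-formal deformations *)

Section Submodules.
Variables (R : nzRingType) (M : lmodType R).
Implicit Types S : M -> Prop.

Definition is_submodule S : Prop :=
  S 0 /\ forall (c : R) x y, S x -> S y -> S (c *: x + y).

Definition free_finite_rank S : Prop :=
  exists (m : nat) (b : 'I_m -> M),
    (forall x, S x <-> exists c : 'I_m -> R, x = \sum_i c i *: b i) /\
    (forall c : 'I_m -> R, \sum_i c i *: b i = 0 -> forall i, c i = 0).

(* F_n is the internal direct sum of G_0, ..., G_n, for all n. *)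
Definition splits_filtration (F G : nat -> M -> Prop) : Prop :=
  (forall n, is_submodule (G n)) /\
  forall n,
    (forall x, F n x <->
       exists g : 'I_n.+1 -> M, (forall i : 'I_n.+1, G i (g i)) /\ x = \sum_i g i) /\
    (forall g : 'I_n.+1 -> M, (forall i : 'I_n.+1, G i (g i)) -> \sum_i g i = 0 ->
       forall i, g i = 0).

End Submodules.

(* R is local with residue field k through rho, and is the limit of its Artinian
   quotients by a directed family J of ideals. *)
Definition complete_pro_artin_local (k : fieldType) (R : comNzRingType)
    (rho : {rmorphism R -> k}) : Prop :=
  [/\ forall c, exists r, rho r = c,
      forall r, rho r != 0 -> exists s, r * s = 1
    & exists (T : Type) (J : T -> R^o -> Prop),
      [/\ forall t, is_submodule (J t) /\ (forall r, J t r -> rho r = 0),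
          forall s t, exists u, forall r, J u r -> J s r /\ J t r,
          forall t (C : nat -> R^o -> Prop),
            (forall n, is_submodule (C n)) ->
            (forall n r, J t r -> C n r) ->
            (forall n r, C n.+1 r -> C n r) ->
            exists N, forall n r, (N <= n)%N -> C N r -> C n r,
          forall r, (forall t, J t r) -> r = 0
        & forall x : T -> R,
            (forall s t, (forall r, J s r -> J t r) -> J t (x s - x t)) ->
            exists r, forall t, J t (r - x t)]].

(* The subalgebra generated by s, the scalars acting through iota. *)
Inductive gen_subalg (k : Type) (B : nzRingType) (iota : k -> B) (s : seq B) :
    B -> Prop :=
| gen_scalar c : gen_subalg iota s (iota c)
| gen_gen x : x \in s -> gen_subalg iota s x
| gen_sub x y : gen_subalg iota s x -> gen_subalg iota s y ->
    gen_subalg iota s (x - y)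
| gen_mul x y : gen_subalg iota s x -> gen_subalg iota s y ->
    gen_subalg iota s (x * y).

(* [Ahat] with its filtration [F] is a semi-formal deformation of [A] over [R],
   the identification of A with Ahat (x)_R k being given by [pi]: since
   Ahat (x)_R k = Ahat / (ker rho) Ahat, this is a surjective morphism of
   algebras over rho, with kernel (ker rho) Ahat. *)
Record semiformal_deformation (k : fieldType) (R : comNzRingType)
    (rho : {rmorphism R -> k}) (A : algType k) (Ahat : algType R)
    (pi : {lrmorphism Ahat -> A | rho \; *:%R}) (F : nat -> Ahat -> Prop) :
    Prop := {
  sfd_base : complete_pro_artin_local rho;
  sfd_fingen : exists s : seq A, forall a, gen_subalg (fun c : k => c%:A) s a;
  sfd_pi_surj : forall a, exists x, pi x = a;
  sfd_pi_ker : forall x, pi x = 0 <->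
    exists (m : nat) (r : 'I_m -> R) (y : 'I_m -> Ahat),
      (forall i, rho (r i) = 0) /\ x = \sum_i r i *: y i;
  sfd_increasing : forall n x, F n x -> F n.+1 x;
  sfd_exhaustive : forall x, exists n, F n x;
  sfd_free : forall n, free_finite_rank (F n);
  sfd_one : F 0%N 1;
  sfd_mul : forall m n x y, F m x -> F n y -> F (m + n)%N (x * y);
  sfd_splitting : exists G, splits_filtration F G;
  sfd_rees : exists s : seq {poly A}, forall p : {poly A},
    gen_subalg (fun c : k => (c%:A)%:P) s p <->
    forall n, exists2 x, F n x & pi x = p`_n
}.

(* The maps F_n -> B given by [sigma n] induce an isomorphism of algebras from
   gr A = (+)_n F_n / F_(n-1) (with F_(-1) = 0) to B. *)
Record is_associated_graded (R : comNzRingType) (A B : algType R)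
    (F : nat -> A -> Prop) (sigma : nat -> A -> B) : Prop := {
  gr_linear : forall n (c : R) x y, F n x -> F n y ->
    sigma n (c *: x + y) = c *: sigma n x + sigma n y;
  gr_ker : forall n x, F n x ->
    (sigma n x = 0 <-> if n is m.+1 then F m x else x = 0);
  gr_span : forall b, exists (N : nat) (x : nat -> A),
    (forall n, F n (x n)) /\ b = \sum_(n < N) sigma n (x n);
  gr_direct : forall (N : nat) (x : nat -> A), (forall n, F n (x n)) ->
    \sum_(n < N) sigma n (x n) = 0 ->
    forall n, (n < N)%N -> sigma n (x n) = 0;
  gr_one : sigma 0%N 1 = 1;
  gr_mul : forall m n x y, F m x -> F n y ->
    sigma (m + n)%N (x * y) = sigma m x * sigma n y
}.

(* Main.v *)
Require Import Defs.
From HB Require Import structures.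
From mathcomp Require Import all_boot all_order all_algebra.
From mathcomp Require Import boolp.
From mathcomp Require Import mpoly.
From mathcomp Require Import zify.

Set Implicit Arguments.
Unset Strict Implicit.
Unset Printing Implicit Defensive.

Import Order.TTheory GRing.Theory Num.Theory.
Local Open Scope ring_scope.

(** The key fact is a count of degrees. In an operator attached to a graph with
    [n] inner vertices, each inner vertex carries a coefficient of degree at most
    2, and [2 n] derivations are applied; hence the operator does not raise the
    total degree, and its part of degree 0 only sees the quadratic parts of the
    coefficients. This is [graph_op_symbol], phrased with the relation
    [has_symbol z f s] (the degree of [f] is at most [z], with leading part
    [s]), which is stable under sums, products and derivatives. It gives at once
    the closure of the series of bounded degree under the star product, its
    compatibility with the filtration by the degree ([star_msize]), the
    description of the associated graded algebra ([star_associated_graded]), the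
    homogeneity in the quadratic case, and, applied to the Jacobi identity, the
    fact that the quadratic part is Poisson ([poisson_symbol]).

    An element of [k[V][[h]]], with [h] the formal parameter, lies in the tensor product of [k[V]] with [k[[h]]]
    if and only if the degrees of its coefficients are bounded
    ([fps_tensorT]), because polynomials of bounded degree have finitely many
    monomials. The same monomials are bases of the filtration.

    The polynomial 1 need not be a unit for the star product defined by abstract
    weights. But its star square is a scalar series [c = 1 + O(h)], by degree,
    so [c^-1] times 1 is idempotent, and multiplication by an idempotent which
    is 1 modulo [h] is the identity ([star_unit]). This unit lies in the
    first step of the filtration, as a semi-formal deformation requires. *)

(** * Power series with coefficients in a module *)

(** Reindexing of the sum over [a + b <= N] by [i = a + b]. *)
Lemma big_triangle (V : nmodType) (f : nat -> nat -> V) N :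
  \sum_(i < N.+1) \sum_(a < i.+1) f a (i - a)%N =
  \sum_(a < N.+1) \sum_(b < (N - a).+1) f a b.
Proof.
elim: N => [|N IHN]; first by rewrite !big_ord1.
rewrite big_ord_recr /= IHN [RHS]big_ord_recr /= subnn big_ord1.
rewrite [X in _ + X]big_ord_recr /= subnn addrA; congr (_ + _).
rewrite -big_split /=; apply: eq_bigr => a _.
by rewrite (subSn (leq_ord a)) [RHS]big_ord_recr.
Qed.

Lemma big_triangle_exchange (V : nmodType) (f : nat -> nat -> V) N :
  \sum_(a < N.+1) \sum_(b < (N - a).+1) f a b =
  \sum_(b < N.+1) \sum_(a < (N - b).+1) f a b.
Proof.
rewrite -big_triangle -(big_triangle (fun b a => f a b)).
apply: eq_bigr => i _; rewrite (reindex_inj rev_ord_inj); apply: eq_bigr => a _.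
by rewrite /= subSS subKn // leq_ord.
Qed.

Section FpsModule.
Variables (k : comNzRingType) (M : lmodType k).
Implicit Types (a b c : fps k) (F G : fps M).

Fact fps_scaleA a b F : fps_scale a (fps_scale b F) = fps_scale (a * b) F.
Proof.
apply: fpsP => N /=.
transitivity (\sum_(i < N.+1) \sum_(j < (N - i).+1)
    (a i * b j) *: F (N - (i + j))%N).
  apply: eq_bigr => i _; rewrite scaler_sumr; apply: eq_bigr => j _.
  by rewrite scalerA subnDA.
rewrite -(big_triangle (fun i j => (a i * b j) *: F (N - (i + j))%N)).
apply: eq_bigr => i _; rewrite scaler_suml; apply: eq_bigr => j _.
by rewrite subnKC // leq_ord.
Qed.

Fact fps_scale1 F : fps_scale 1 F = F.
Proof.
apply: fpsP => N /=; rewrite big_ord_recl /= scale1r subn0 big1 ?addr0 //.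
by move=> i _; rewrite scale0r.
Qed.

Fact fps_scaleDr (a : fps k) : {morph @fps_scale k M a : F G / F + G}.
Proof.
move=> F G; apply: fpsP => N /=; rewrite -big_split; apply: eq_bigr => i _.
by rewrite scalerDr.
Qed.

Fact fps_scaleDl F : {morph (fun a => fps_scale a F) : a b / a + b}.
Proof.
move=> a b; apply: fpsP => N /=; rewrite -big_split; apply: eq_bigr => i _.
by rewrite scalerDl.
Qed.

HB.instance Definition _ := GRing.Zmodule_isLmodule.Build (fps k) (fps M)
  fps_scaleA fps_scale1 fps_scaleDr fps_scaleDl.

Lemma fps_coefZ a F N : (a *: F) N = \sum_(i < N.+1) a i *: F (N - i)%N.
Proof. by []. Qed.

Lemma fps_coefD F G N : (F + G) N = F N + G N.
Proof. by []. Qed.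

Lemma fps_coef_sum (I : Type) (r : seq I) (P : pred I) (F : I -> fps M) N :
  (\sum_(i <- r | P i) F i) N = \sum_(i <- r | P i) F i N.
Proof. by elim/big_rec2: _ => // i _ G _ <-. Qed.

Lemma fps_coefZ_const a (p : M) N : (a *: fps_const p) N = a N *: p.
Proof.
rewrite fps_coefZ big_ord_recr /= subnn big1 ?add0r // => i _.
by case: (N - i)%N (subn_gt0 i N) (ltn_ord i) => [|j _ _]; rewrite ?scaler0 // => <-.
Qed.

End FpsModule.

Section FpsUnit.
Variable k : fieldType.
Implicit Types F G U : fps k.

Lemma fps_coefM F G N : (F * G) N = \sum_(i < N.+1) F i * G (N - i)%N.
Proof. by []. Qed.

Lemma fps_exp_order U n i : U 0%N = 0 -> (i < n)%N -> (U ^+ n) i = 0.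
Proof.
move=> U0; elim: n i => [//|n IHn] i lt_in.
rewrite exprS fps_coefM big_ord_recl /= U0 mul0r add0r big1 // => j _.
by rewrite IHn ?mulr0 // /bump leq0n; have := ltn_ord j; lia.
Qed.

(** A series with nonzero constant term is, up to a scalar, [1 - U] with
    [U 0 = 0], and its inverse is the geometric series of [U], each
    coefficient of which is a finite sum. *)
Lemma fps_unit F : F 0%N != 0 -> exists G, F * G = 1.
Proof.
move=> F0; pose c : fps k := fps_const (F 0%N)^-1.
have cE G N : (c * G) N = (F 0%N)^-1 * G N.
  by rewrite fps_coefM big_ord_recl /= subn0 big1 ?addr0 // => i _; rewrite mul0r.
pose U : fps k := 1 - c * F.
have U0 : U 0%N = 0.
  by rewrite -[U 0%N]/(1 - (c * F) 0%N) cE mulVf // subrr.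
pose W : fps k := Fps (fun i => \sum_(n < i.+1) (U ^+ n) i).
exists (c * W); rewrite mulrCA mulrA.
suff defW : U * W = W - 1.
  by rewrite -[c * F](subKr 1) -/U mulrBl mul1r defW subKr.
apply: fpsP => N; rewrite fps_coefM.
transitivity (\sum_(n < N.+1) (U ^+ n.+1) N); last first.
  rewrite big_ord_recr fps_exp_order //=.
  rewrite addr0 -[RHS]/(W N - (1 : fps k) N).
  by rewrite [W N]big_ord_recl addrAC subrr add0r.
have -> : \sum_(n < N.+1) (U ^+ n.+1) N
        = \sum_(n < N.+1) \sum_(i < N.+1) U i * (U ^+ n) (N - i)%N.
  by apply: eq_bigr => n _; rewrite exprS fps_coefM.
rewrite exchange_big; apply: eq_bigr => i _; rewrite -mulr_sumr; congr (_ * _).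
rewrite /= (big_ord_widen N.+1 (fun n => (U ^+ n) (N - i)%N)) ?ltnS ?leq_subr //.
rewrite big_mkcond; apply: eq_bigr => n _; case: ltnP => // lt.
by rewrite fps_exp_order.
Qed.

End FpsUnit.

(** * The ring of formal power series is complete, local and pro-Artinian *)

Section FpsBase.
Variable k : fieldType.
Implicit Types F G : fps k.

Definition fps_ideal (t : nat) F : Prop := forall i, (i < t)%N -> F i = 0.

Lemma fps_ideal_submodule t : is_submodule (fps_ideal t : fps k^o -> Prop).
Proof.
split=> [//|c F G IF IG i lt_it].
rewrite fps_coefD IG // addr0 [LHS]fps_coefM big1 // => j _.
by rewrite IF ?mulr0 //; lia.
Qed.

(** If [F] has order [s <= t], then [F = h^s F'] with [F'] invertible, and every
    element of [fps_ideal t] is a multiple of [h^s]. *)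
Lemma fps_ideal_min (C : (fps k)^o -> Prop) F t s :
  is_submodule C -> C F -> (s <= t)%N -> F s != 0 -> fps_ideal s F ->
  forall G, fps_ideal t G -> C G.
Proof.
move=> [C0 CD] CF le_st Fs IF G IG.
have [H /= FH] : exists H, (Fps (fun i => F (i + s)%N) : fps k) * H = 1.
  exact: fps_unit.
suff -> : G = Fps (fun i => G (i + s)%N) * H * F.
  by rewrite -[_ * F]addr0; apply: CD.
have shiftE (K L : fps k) : fps_ideal s L ->
    K * L = Fps (fun i => if (i < s)%N then 0
                          else (K * Fps (fun j => L (j + s)%N)) (i - s)%N).
  move=> IL; apply: fpsP => i; rewrite [LHS]fps_coefM [RHS]/=.
  have [lt_is|le_si] := ltnP i s.
    by rewrite big1 // => j _; rewrite IL ?mulr0 //; lia.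
  rewrite (big_ord_widen i.+1 (fun j => K j * L (i - s - j + s)%N)); last by lia.
  rewrite [RHS]big_mkcond; apply: eq_bigr => j _; case: ltnP => lt_j.
    by congr (_ * L _); lia.
  by rewrite IL ?mulr0 //; have := ltn_ord j; lia.
rewrite shiftE // -mulrA [H * _]mulrC FH mulr1; apply: fpsP => i /=.
case: ltnP => [lt_is|le_si]; last by rewrite subnK.
by rewrite IG //; lia.
Qed.

Lemma fps_order F t : ~ fps_ideal t F ->
  exists s, [/\ (s < t)%N, F s != 0 & fps_ideal s F].
Proof.
elim: t => [nI|t IHt nI]; first by case: nI.
have [It|/IHt [s [lt_st Fs Is]]] := pselect (fps_ideal t F); last first.
  by exists s; split=> //; lia.
exists t; split=> //; apply/negP => /eqP Ft; apply: nI => i.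
by rewrite ltnS leq_eqVlt => /predU1P[->//|/It].
Qed.

(** Ideals containing [h^t] are generated by a power of [h]; this is used through
    an induction on [t], according to whether the whole chain contains [h^t]. *)
Lemma fps_artin t (C : nat -> (fps k)^o -> Prop) :
    (forall n, is_submodule (C n)) ->
    (forall n F, fps_ideal t F -> C n F) ->
    (forall n F, C n.+1 F -> C n F) ->
  exists N, forall n F, (N <= n)%N -> C N F -> C n F.
Proof.
move=> subC; elim: t => [|t IHt] ItC decC.
  by exists 0%N => n F _ _; apply: ItC.
have [/IHt/(_ decC) //|] := pselect (forall n F, fps_ideal t F -> C n F).
(* Otherwise some [C N] has no element of order at most [t]: it is the ideal of
   series of order at least [t.+1]. *)
move=> /existsNP[N /existsNP[G /not_implyP[IG nCG]]].
exists N => n F _ CF; apply: ItC.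
apply: contrapT => /fps_order[s [lt_st Fs Is]]; apply: nCG.
exact: (fps_ideal_min (subC N) CF (s := s) (t := t)).
Qed.

(** The compatible family [x] is glued diagonally: its [t]-th member determines
    the coefficients up to [h^t]. *)
Lemma fps_complete_pro_artin :
  complete_pro_artin_local (@fps_residue k : {rmorphism fps k -> k}).
Proof.
split=> [c|F F0|]; first by exists (fps_const c).
  exact: fps_unit.
exists nat, (fun t => fps_ideal t.+1); split.
- move=> t; split; first exact: fps_ideal_submodule.
  by move=> F; apply.
- move=> s t; exists (maxn s t) => F IF; split=> i lt_i; apply: IF; lia.
- by move=> t; apply: fps_artin.
- by move=> F F0; apply: fpsP => i; apply: (F0 i).
move=> x xP; exists (Fps (fun i => x i i)) => t i lt_it.
have /(xP t i) xti : forall F, fps_ideal t.+1 F -> fps_ideal i.+1 F.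
  by move=> F IF j lt_ji; apply: IF; lia.
by have /eqP := xti i (ltnSn i); rewrite subr_eq0 => /eqP /= ->; rewrite subrr.
Qed.

End FpsBase.

(** * Principal symbols *)

Section Symbol.
Variables (k : fieldType) (d : nat).
Implicit Types (f g s t p : {mpoly k[d]}) (m : 'X_{1..d}) (z : int).

(** [f] has degree at most [z], and [s] is its homogeneous part of degree [z].
    The degree is an integer, since a derivation lowers it by one also when it
    is zero. *)
Definition has_symbol z f s : Prop :=
  (forall m, f@_m != 0 -> (mdeg m)%:Z <= z) /\
  (forall m, s@_m = if (mdeg m)%:Z == z then f@_m else 0).

Lemma has_symbol0 z : has_symbol z 0 0.
Proof. by split=> m; rewrite mcoeff0 ?eqxx ?if_same. Qed.

Lemma has_symbol1 : has_symbol 0 1 1.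
Proof.
have m1E m : (1 : {mpoly k[d]})@_m = (mdeg m == 0%N)%:R.
  by rewrite mcoeff1 mdeg_eq0.
split=> m; rewrite !m1E ?eqz_nat.
  by case: (mdeg m =P 0%N) => [->|]; rewrite ?eqxx.
by case: eqP.
Qed.

Lemma has_symbolD z f g s t :
  has_symbol z f s -> has_symbol z g t -> has_symbol z (f + g) (s + t).
Proof.
move=> [fz sE] [gz tE]; split=> m; rewrite !mcoeffD; last first.
  by rewrite sE tE; case: ifP; rewrite ?addr0.
have [->|/fz//] := eqVneq f@_m 0; rewrite add0r; exact: gz.
Qed.

Lemma has_symbolZ z c f s : has_symbol z f s -> has_symbol z (c *: f) (c *: s).
Proof.
move=> [fz sE]; split=> m; rewrite !mcoeffZ.
  by rewrite mulf_eq0 negb_or => /andP[_ /fz].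
by rewrite sE; case: ifP; rewrite ?mulr0.
Qed.

Lemma has_symbol_sum z (I : Type) (r : seq I) (P : pred I)
    (F G : I -> {mpoly k[d]}) :
  (forall i, P i -> has_symbol z (F i) (G i)) ->
  has_symbol z (\sum_(i <- r | P i) F i) (\sum_(i <- r | P i) G i).
Proof.
move=> FG; elim/big_rec2: _ => [|i g f Pi fg]; first exact: has_symbol0.
exact: has_symbolD (FG i Pi) fg.
Qed.

Lemma has_symbolM z z' f g s t :
  has_symbol z f s -> has_symbol z' g t -> has_symbol (z + z') (f * g) (s * t).
Proof.
move=> [fz sE] [gz tE]; split=> m; rewrite !mcoeffM.
  apply: contraNT; rewrite -ltNge => lt_zm.
  apply/eqP/big1 => -[/= m1 m2] /eqP /(congr1 mdeg) /=; rewrite mdegD => m12.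
  have [->|/fz le1] := eqVneq f@_m1 0; first by rewrite mul0r.
  by have [->|/gz le2] := eqVneq g@_m2 0; [rewrite mulr0 | lia].
transitivity (\sum_(q : 'X_{1..d < (mdeg m).+1, (mdeg m).+1}
                | m == (q.1 + q.2)%MM)
    if (mdeg m)%:Z == z + z' then f@_q.1 * g@_q.2 else 0); last first.
  by case: ifP => // _; rewrite big1.
apply: eq_bigr => -[/= m1 m2] /eqP /(congr1 mdeg) /=; rewrite mdegD => m12.
rewrite sE tE.
have [->|/fz le1] := eqVneq f@_m1 0; first by rewrite !(mul0r, if_same).
have [->|/gz le2] := eqVneq g@_m2 0; first by rewrite !(mulr0, if_same).
case: (_ =P z) => d1; case: (_ =P z') => d2; case: (_ =P z + z') => d12 //;
  by rewrite ?(mul0r, mulr0) //; lia.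
Qed.

Lemma has_symbol_prod (I : Type) (r : seq I) (P : pred I) (D : I -> int)
    (F G : I -> {mpoly k[d]}) :
  (forall i, P i -> has_symbol (D i) (F i) (G i)) ->
  has_symbol (\sum_(i <- r | P i) D i)
    (\prod_(i <- r | P i) F i) (\prod_(i <- r | P i) G i).
Proof.
move=> FG; elim/big_rec3: _ => [|i g f z Pi fg]; first exact: has_symbol1.
exact: has_symbolM (FG i Pi) fg.
Qed.

Lemma has_symbol_derivm z f s m0 :
  has_symbol z f s -> has_symbol (z - (mdeg m0)%:Z) f^`M[m0] s^`M[m0].
Proof.
move=> [fz sE]; split=> m; rewrite !mcoeff_mderivm.
  have [->|/fz] := eqVneq f@_(m0 + m) 0; first by rewrite mul0rn eqxx.
  by rewrite mdegD => le1 _; lia.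
rewrite sE mdegD.
have -> : ((mdeg m)%:Z == z - (mdeg m0)%:Z) = ((mdeg m0 + mdeg m)%:Z == z).
  by lia.
by case: ifP; rewrite ?mul0rn.
Qed.

Lemma has_symbol_inj z f s t : has_symbol z f s -> has_symbol z f t -> s = t.
Proof. by move=> [_ sE] [_ tE]; apply/mpolyP => m; rewrite sE tE. Qed.

Lemma mcoeff_pihomog n p m :
  (pihomog mdeg n p)@_m = if mdeg m == n then p@_m else 0.
Proof.
rewrite pihomogE raddf_sum /=.
have [m_in|m_out] := boolP (m \in msupp p); last first.
  rewrite (memN_msupp_eq0 m_out) if_same big1_seq // => m' /andP[_ m'_in].
  rewrite mcoeffZ mcoeffX; case: eqP => [m'm|]; rewrite ?mulr0 //.
  by rewrite -m'm m'_in in m_out.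
rewrite big_mkcond (bigD1_seq m) ?msupp_uniq //= big1 ?addr0 => [|m' /negPf nm].
  by case: ifP; rewrite // mcoeffZ mcoeffX eqxx mulr1.
by case: ifP; rewrite // mcoeffZ mcoeffX nm mulr0.
Qed.

Lemma msize_leP n p :
  reflect (forall m, p@_m != 0 -> (mdeg m < n)%N) (msize p <= n)%N.
Proof.
apply: (iffP idP) => [le_pn m|le_pn].
  by rewrite -mcoeff_msupp => /msize_mdeg_lt; lia.
by rewrite msizeE; apply/bigmax_leqP_seq => m; rewrite mcoeff_msupp => /le_pn.
Qed.

Lemma has_symbol_pihomog n f :
  (msize f <= n.+1)%N -> has_symbol n f (pihomog mdeg n f).
Proof.
by move=> /msize_leP fn; split=> m; [move/fn|rewrite mcoeff_pihomog eqz_nat].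
Qed.

Lemma has_symbol_msize n f s : has_symbol n%:Z f s -> (msize f <= n.+1)%N.
Proof. by move=> [fn _]; apply/msize_leP => m /fn; rewrite lez_nat. Qed.

Lemma has_symbolE n f s : has_symbol n%:Z f s -> s = pihomog mdeg n f.
Proof.
move=> fs; apply: (has_symbol_inj fs); apply: has_symbol_pihomog.
exact: has_symbol_msize fs.
Qed.

Lemma homog_has_symbol n f : f \is n.-homog -> has_symbol n f f.
Proof.
move=> hf; rewrite -[X in has_symbol _ _ X](pihomog_dE hf).
apply/has_symbol_pihomog/msize_leP => m; rewrite -mcoeff_msupp => m_in.
by move/dhomogP: hf => /(_ m m_in) ->.
Qed.

Lemma has_symbol_homog n f s : has_symbol n%:Z f s -> s \is n.-homog.
Proof. by move/has_symbolE ->; apply: pihomogP. Qed.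

End Symbol.

(** * Brackets and star products of symbols *)

Section SymbolStar.
Variables (k : fieldType) (w : forall n, kgraph n -> k) (d : nat).
Implicit Types (f g h s t : {mpoly k[d]}) (gamma : 'M[{mpoly k[d]}]_d).
Implicit Types (F G : fps {mpoly k[d]}).

Definition quadratic_symbol gamma gamma2 : Prop :=
  forall i j, has_symbol 2 (gamma i j) (gamma2 i j).

Lemma quadratic_partP gamma :
  (forall i j, (msize (gamma i j) <= 3)%N) ->
  quadratic_symbol gamma (quadratic_part gamma).
Proof. by move=> le3 i j; rewrite mxE; apply: has_symbol_pihomog. Qed.

Section Fixed.
Variables gamma gamma2 : 'M[{mpoly k[d]}]_d.
Hypothesis gammaP : quadratic_symbol gamma gamma2.

Lemma bracket_symbol y z f g s t : has_symbol y f s -> has_symbol z g t ->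
  has_symbol (y + z) (bracket gamma f g) (bracket gamma2 s t).
Proof.
move=> fs gt; apply: has_symbol_sum => i _; apply: has_symbol_sum => j _.
have -> : y + z = 2 + (y - (mdeg U_(i))%:Z) + (z - (mdeg U_(j))%:Z).
  by rewrite !mdeg1; lia.
rewrite -!mderivmU1m; apply: has_symbolM (has_symbol_derivm _ gt).
exact: has_symbolM (gammaP i j) (has_symbol_derivm _ fs).
Qed.

(** Each inner vertex of a graph carries a quadratic coefficient and emits two
    edges, so that the degree won at the vertices is lost at the edges. *)
Lemma graph_op_symbol n (Gam : kgraph n) y z f g s t :
  has_symbol y f s -> has_symbol z g t ->
  has_symbol (y + z) (graph_op gamma Gam f g) (graph_op gamma2 Gam s t).
Proof.
move=> fs gt; apply: has_symbol_sum => I _.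
pose D v := (mdeg (in_derivs Gam I v))%:Z.
have sumD : \sum_v D v = (2 * n)%:Z.
  have DE v : D v = \sum_(e | val Gam e == v) 1.
    rewrite /D mdeg_sum (big_morph Posz PoszD (erefl (Posz 0))).
    by apply: eq_bigr => e _; rewrite mdeg1.
  transitivity (\sum_(e : 'I_n * bool) (1 : int)).
    by rewrite (partition_big (val Gam) xpredT) //; apply: eq_bigr.
  by rewrite sumr_const card_prod card_ord card_bool mulnC natz.
have -> : y + z = \sum_(v < n) (2 - D (inl v)) + (y - D (inr false))
                  + (z - D (inr true)).
  move: sumD; rewrite big_sumType /= big_bool /= sumrB sumr_const card_ord.
  by rewrite -mulr_natr; set S := \sum_(i < n) _; lia.
apply: has_symbolM (has_symbol_derivm _ gt).
apply: has_symbolM (has_symbol_derivm _ fs).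
by apply: has_symbol_prod => v _; apply: has_symbol_derivm.
Qed.

Lemma star_term_symbol n y z f g s t :
  has_symbol y f s -> has_symbol z g t ->
  has_symbol (y + z) (star_term w gamma n f g) (star_term w gamma2 n s t).
Proof.
case: n => [|n] fs gt; first exact: has_symbolM.
by apply: has_symbol_sum => Gam _; apply/has_symbolZ/graph_op_symbol.
Qed.

Lemma star_symbol y z F G (S T : fps {mpoly k[d]}) :
  (forall i, has_symbol y (F i) (S i)) -> (forall i, has_symbol z (G i) (T i)) ->
  forall i, has_symbol (y + z) (star w gamma F G i) (star w gamma2 S T i).
Proof.
move=> FS GT N; apply: has_symbol_sum => i _; apply: has_symbol_sum => j _.
exact: star_term_symbol.
Qed.

End Fixed.

Lemma bracketDl gamma f g h :
  bracket gamma (f + g) h = bracket gamma f h + bracket gamma g h.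
Proof.
rewrite -big_split; apply: eq_bigr => i _; rewrite -big_split; apply: eq_bigr.
by move=> j _; rewrite mderivD mulrDr mulrDl.
Qed.

Lemma bracketDr gamma f g h :
  bracket gamma h (f + g) = bracket gamma h f + bracket gamma h g.
Proof.
rewrite -big_split; apply: eq_bigr => i _; rewrite -big_split; apply: eq_bigr.
by move=> j _; rewrite mderivD mulrDr.
Qed.

Definition jacobiator gamma f g h : {mpoly k[d]} :=
  bracket gamma f (bracket gamma g h) + bracket gamma g (bracket gamma h f)
  + bracket gamma h (bracket gamma f g).

Lemma jacobiatorC gamma f g h : jacobiator gamma f g h = jacobiator gamma g h f.
Proof. by rewrite /jacobiator -addrA addrC. Qed.

Lemma jacobiatorD gamma f f' g h :
  jacobiator gamma (f + f') g h = jacobiator gamma f g h + jacobiator gamma f' g h.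
Proof.
by rewrite /jacobiator !(bracketDl, bracketDr) [X in X + _]addrACA [LHS]addrACA.
Qed.

(** On homogeneous arguments the Jacobiator of the quadratic part is the top
    degree part of the Jacobiator, hence zero; trilinearity does the rest. *)
Lemma poisson_symbol gamma gamma2 : quadratic_symbol gamma gamma2 ->
  is_poisson gamma -> is_poisson gamma2.
Proof.
move=> gP [asym jac]; split.
  apply/matrixP => i j; rewrite !mxE; apply: has_symbol_inj (gP j i) _.
  have := congr1 (fun A : 'M_d => A i j) asym; rewrite !mxE => ->.
  by rewrite -!scaleN1r; apply: has_symbolZ.
have jac_homog p q r f g h : f \is p.-homog -> g \is q.-homog -> h \is r.-homog ->
    jacobiator gamma2 f g h = 0.
  move=> /homog_has_symbol fp /homog_has_symbol gq /homog_has_symbol hr.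
  have := jac f g h; rewrite -/(jacobiator _ _ _ _) => jac0.
  suff : has_symbol (p%:Z + q%:Z + r%:Z) (jacobiator gamma f g h)
                                         (jacobiator gamma2 f g h).
    by rewrite jac0 => /has_symbol_inj; apply; apply: has_symbol0.
  apply: has_symbolD; first apply: has_symbolD.
  - rewrite -addrA; exact: (bracket_symbol gP fp (bracket_symbol gP gq hr)).
  - have -> : p%:Z + q%:Z + r%:Z = q%:Z + (r%:Z + p%:Z) by lia.
    exact: (bracket_symbol gP gq (bracket_symbol gP hr fp)).
  - rewrite addrC; exact: (bracket_symbol gP hr (bracket_symbol gP fp gq)).
have ext1 g h : (forall n f, f \is n.-homog -> jacobiator gamma2 f g h = 0) ->
    forall f, jacobiator gamma2 f g h = 0.
  move=> jac_h f; rewrite (pihomog_partitionE (leqnn (mmeasure mdeg f))).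
  elim/big_rec: _ => [|n f' _ IHf]; first exact/(jac_h 0%N)/dhomog0.
  by rewrite jacobiatorD IHf addr0 (jac_h n) ?pihomogP.
move=> f g h; rewrite -/(jacobiator _ _ _ _).
apply: (ext1) => {f} p f fp; rewrite jacobiatorC.
apply: (ext1) => {g} q g gq; rewrite jacobiatorC.
apply: (ext1) => {h} r h hr.
exact: jac_homog hr fp gq.
Qed.

End SymbolStar.

(** * Tensor products with the ring of power series *)

Section Tensor.
Variables (k : fieldType) (d : nat).
Implicit Types (p : {mpoly k[d]}) (F : fps {mpoly k[d]}).

Lemma fps_tensor_coef (M : lmodType k) (S : M -> Prop) (F : fps M) :
  is_submodule S -> fps_tensor S F -> forall i, S (F i).
Proof.
move=> [S0 SD] [m [a [p [Sp ->]]]] i; rewrite fps_coef_sum.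
elim/big_ind: _ => // [x y Sx Sy|j _]; first by rewrite -[x]scale1r; apply: SD.
rewrite -[fps_scale _ _ i]/((a j *: fps_const (p j)) i) fps_coefZ_const.
by rewrite -[_ *: _]addr0; apply: SD.
Qed.

Lemma fps_monomials n F : (forall i, msize (F i) <= n)%N ->
  F = \sum_(m : 'X_{1..d < n}) (Fps (fun i => (F i)@_m)) *: fps_const 'X_[m].
Proof.
move=> Fn; apply: fpsP => i; rewrite fps_coef_sum [LHS](mpolywE (Fn i)).
by apply: eq_bigr => m _; rewrite fps_coefZ_const.
Qed.

(** The monomials satisfying [P] are finite in number, and they are a basis of
    the polynomials whose monomials satisfy [P]. *)
Lemma fps_tensor_monomials (S : {mpoly k[d]} -> Prop) (P : pred 'X_{1..d}) n F :
    (forall m, P m -> mdeg m < n)%N ->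
    (forall p, S p <-> forall m, p@_m != 0 -> P m) ->
  fps_tensor S F <-> forall i, S (F i).
Proof.
move=> Pn SP; split=> [|SF].
  apply: fps_tensor_coef; split=> [|c x y /SP Sx /SP Sy]; apply/SP => m.
    by rewrite mcoeff0 eqxx.
  rewrite mcoeffD mcoeffZ; have [->|/Sx//] := eqVneq x@_m 0.
  by rewrite mulr0 add0r => /Sy.
pose e (j : 'I_#|{: 'X_{1..d < n}}|) : 'X_{1..d < n} := enum_val j.
exists #|{: 'X_{1..d < n}}|, (fun j => Fps (fun i => (F i)@_(e j))).
exists (fun j => if P (e j) then 'X_[e j] else 0); split.
  move=> j; apply/SP => m; case: ifP => [Pj|_].
    by rewrite mcoeffX; have [<-//|_] := eqVneq (bmnm (e j)) m; rewrite eqxx.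
  by rewrite mcoeff0 eqxx.
have FP i := (SP _).1 (SF i).
rewrite {1}(@fps_monomials n F) => [|i]; last by apply/msize_leP => m /FP /Pn.
rewrite (reindex e); last by apply: onW_bij; apply: enum_val_bij.
apply: eq_bigr => j _; case: ifPn => // nPj.
suff -> : Fps (fun i => (F i)@_(e j)) = 0 by rewrite scale0r; apply/esym/scale0r.
by apply: fpsP => i /=; apply: contraNeq nPj => /FP.
Qed.

Lemma fps_tensor_le n F :
  fps_tensor (fun p => is_true (msize p <= n.+1)%N) F <->
  forall i, (msize (F i) <= n.+1)%N.
Proof.
apply: (@fps_tensor_monomials _ (fun m => (mdeg m < n.+1)%N) n.+1) => // p.
by split=> /msize_leP.
Qed.

Lemma fps_tensor_homog n F :
  fps_tensor (fun p => is_true (p \is n.-homog)) F <->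
  forall i, F i \is n.-homog.
Proof.
apply: (@fps_tensor_monomials _ (fun m => mdeg m == n) n.+1) => [m /eqP->//|p].
split=> [/dhomogP hp m|hp].
  by rewrite -mcoeff_msupp => /hp ->.
by apply/dhomogP => m; rewrite mcoeff_msupp => /hp /eqP.
Qed.

Lemma fps_tensorT F :
  fps_tensor (fun=> True) F <-> exists n, forall i, (msize (F i) <= n.+1)%N.
Proof.
split=> [[m [a [p [_ ->]]]]|[n /fps_tensor_le[m [a [p [_ ->]]]]]]; last first.
  by exists m, a, p.
exists (\max_(j < m) msize (p j)); apply/fps_tensor_le.
exists m, a, p; split=> // j; apply: leqW.
exact: (leq_bigmax (F := fun j => msize (p j))).
Qed.

End Tensor.

(** * The star product is bilinear and has a scalar unit *)

Section StarBilinear.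
Variables (k : fieldType) (w : forall n, kgraph n -> k) (d : nat).
Variable gamma : 'M[{mpoly k[d]}]_d.
Implicit Types (f g h : {mpoly k[d]}) (F G H : fps {mpoly k[d]}) (c : fps k).

Lemma graph_op_linearl n (Gam : kgraph n) g :
  linear (fun f => graph_op gamma Gam f g).
Proof.
move=> a f h; rewrite scaler_sumr -big_split; apply: eq_bigr => I _ /=.
by rewrite linearP /= mulrDr mulrDl -scalerAr -scalerAl.
Qed.

Lemma graph_op_linearr n (Gam : kgraph n) f : linear (graph_op gamma Gam f).
Proof.
move=> a g h; rewrite scaler_sumr -big_split; apply: eq_bigr => I _ /=.
by rewrite linearP /= mulrDr -scalerAr.
Qed.

Lemma star_term_linearl n g : linear (fun f => star_term w gamma n f g).
Proof.
move=> a f h; case: n => [|n] /=; first by rewrite mulrDl scalerAl.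
rewrite scaler_sumr -big_split; apply: eq_bigr => Gam _ /=.
by rewrite graph_op_linearl scalerDr !scalerA [_ * a]mulrC.
Qed.

Lemma star_term_linearr n f : linear (star_term w gamma n f).
Proof.
move=> a g h; case: n => [|n] /=; first by rewrite mulrDr scalerAr.
rewrite scaler_sumr -big_split; apply: eq_bigr => Gam _ /=.
by rewrite graph_op_linearr scalerDr !scalerA [_ * a]mulrC.
Qed.

(** The coefficient of [h^n] in the operators of right multiplication by [G] and
    of left multiplication by [F], restricted to polynomials. *)
Definition star_opl G n f := \sum_(j < n.+1) star_term w gamma (n - j) f (G j).
Definition star_opr F n g := \sum_(i < n.+1) star_term w gamma (n - i) (F i) g.

Fact star_opl_linear G n : linear (star_opl G n).
Proof.
move=> a f h; rewrite scaler_sumr -big_split; apply: eq_bigr => j _.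
exact: star_term_linearl.
Qed.

Fact star_opr_linear F n : linear (star_opr F n).
Proof.
move=> a f h; rewrite scaler_sumr -big_split; apply: eq_bigr => j _.
exact: star_term_linearr.
Qed.

HB.instance Definition _ G n :=
  GRing.isLinear.Build k _ _ *:%R (star_opl G n) (star_opl_linear G n).
HB.instance Definition _ F n :=
  GRing.isLinear.Build k _ _ *:%R (star_opr F n) (star_opr_linear F n).

Lemma starEl F G N :
  star w gamma F G N = \sum_(i < N.+1) star_opl G (N - i) (F i).
Proof. by []. Qed.

Lemma starEr F G N :
  star w gamma F G N = \sum_(j < N.+1) star_opr F (N - j) (G j).
Proof.
pose t i j := star_term w gamma (N - i - j) (F i) (G j).
transitivity (\sum_(j < N.+1) \sum_(i < (N - j).+1) t i j).
  exact: (big_triangle_exchange t).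
by apply: eq_bigr => j _; apply: eq_bigr => i _; rewrite /t subnAC.
Qed.

(** The terms are regrouped by the power of [h] taken from [c]. Both linearity
    properties of the star product are instances. *)
Lemma fps_apply_linear (M : lmodType k) (T : nat -> {linear M -> M}) c
    (F G : fps M) :
  let ap (H : fps M) := Fps (fun N => \sum_(i < N.+1) T (N - i)%N (H i)) in
  ap (c *: F + G) = c *: ap F + ap G.
Proof.
move=> ap; apply: fpsP => N.
rewrite -[RHS]/((c *: ap F) N + ap G N) fps_coefZ.
rewrite -[LHS]/(\sum_(i < N.+1) T (N - i)%N ((c *: F + G) i)).
rewrite (eq_bigr (fun i : 'I_N.+1 => T (N - i)%N ((c *: F) i) + T (N - i)%N (G i))).
  rewrite big_split /=; congr (_ + _).
  pose t i j := c i *: T (N - (i + j))%N (F j).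
  transitivity (\sum_(i < N.+1) \sum_(a < i.+1) t a (i - a)%N).
    apply: eq_bigr => i _; rewrite linear_sum; apply: eq_bigr => a _.
    by rewrite linearZ /t subnKC // leq_ord.
  rewrite big_triangle; apply: eq_bigr => i _; rewrite scaler_sumr.
  by apply: eq_bigr => j _; rewrite /t subnDA.
by move=> i _; rewrite fps_coefD linearD.
Qed.

Lemma star_linearl G : linear (fun F => star w gamma F G).
Proof. by move=> c F H; apply: (fps_apply_linear (star_opl G)). Qed.

Lemma star_linearr F : linear (star w gamma F).
Proof.
have starE G : star w gamma F G
    = Fps (fun N => \sum_(i < N.+1) star_opr F (N - i)%N (G i)).
  by apply: fpsP => N; apply: starEr.
by move=> c G H; rewrite !starE; apply: (fps_apply_linear (star_opr F)).
Qed.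

Definition star_rmul G F := star w gamma F G.

HB.instance Definition _ G := GRing.isLinear.Build (fps k) _ _ *:%R
  (star_rmul G) (star_linearl G).
HB.instance Definition _ F := GRing.isLinear.Build (fps k) _ _ *:%R
  (star w gamma F) (star_linearr F).

Lemma starZl c F G : star w gamma (c *: F) G = c *: star w gamma F G.
Proof. exact: (linearZZ (star_rmul G)). Qed.

Lemma starZr c F G : star w gamma F (c *: G) = c *: star w gamma F G.
Proof. exact: (linearZZ (star w gamma F)). Qed.

Lemma starDl F G H : star w gamma (F + G) H = star w gamma F H + star w gamma G H.
Proof. exact: (linearD (star_rmul H)). Qed.

Lemma starDr F G H : star w gamma H (F + G) = star w gamma H F + star w gamma H G.
Proof. exact: linearD. Qed.

Lemma star_coef0 F G : star w gamma F G 0%N = F 0%N * G 0%N.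
Proof. by rewrite /star /= !big_ord1. Qed.

(** Modulo higher powers of [h] the star product is the commutative product; so
    multiplication by a series which is 1 modulo [h] is injective. *)
Lemma star_leadl F G N : (forall i, (i < N)%N -> G i = 0) ->
  star w gamma F G N = F 0%N * G N.
Proof.
move=> G0; rewrite starEr big_ord_recr /= subnn big1 => [|j _].
  by rewrite add0r /star_opr big_ord1.
by rewrite G0 // linear0.
Qed.

Lemma star_leadr F G N : (forall i, (i < N)%N -> F i = 0) ->
  star w gamma F G N = F N * G 0%N.
Proof.
move=> F0; rewrite starEl big_ord_recr /= subnn big1 => [|j _].
  by rewrite add0r /star_opl big_ord1.
by rewrite F0 // linear0.
Qed.

Lemma star_injl F G : F 0%N = 1 -> star w gamma F G = 0 -> G = 0.
Proof.
move=> F0 FG; apply: fpsP => N; elim/ltn_ind: N => N IHN.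
by rewrite -[LHS]mul1r -F0 -star_leadl ?FG.
Qed.

Lemma star_injr F G : G 0%N = 1 -> star w gamma F G = 0 -> F = 0.
Proof.
move=> G0 FG; apply: fpsP => N; elim/ltn_ind: N => N IHN.
by rewrite -[LHS]mulr1 -G0 -star_leadr ?FG.
Qed.

(** By degree, the star square of the polynomial 1 is [c] times 1 for a scalar
    series [c = 1 + O(h)], so that [c^-1] times 1 is idempotent. Multiplication
    by it is an idempotent operator equal to the identity modulo [h], hence is
    the identity. *)
Lemma star_unit : associative (star w gamma) ->
    (forall i j, (msize (gamma i j) <= 3)%N) ->
  exists u : fps k, let e := u *: fps_const (1 : {mpoly k[d]}) in
  [/\ e 0%N = 1, left_id e (star w gamma) & right_id e (star w gamma)].
Proof.
move=> starA gamma3; pose I : fps {mpoly k[d]} := fps_const 1.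
pose c : fps k := Fps (fun n => (star w gamma I I n)@_0).
have II : star w gamma I I = c *: I.
  apply: fpsP => n; rewrite fps_coefZ_const alg_mpolyC.
  apply/msize1_polyC/(@has_symbol_msize _ _ 0 _ (star w (quadratic_part gamma) I I n)).
  rewrite -[0%:Z]addr0; apply: star_symbol; first exact: quadratic_partP.
    by case=> [|i]; [apply: has_symbol1 | apply: has_symbol0].
  by case=> [|i]; [apply: has_symbol1 | apply: has_symbol0].
have c0 : c 0%N = 1 by rewrite -[LHS]/((star w gamma I I 0%N)@_0) star_coef0 /= mulr1 mcoeff1 eqxx.
have [|u cu] := @fps_unit _ c; first by rewrite c0 oner_neq0.
have u0 : u 0%N = 1.
  have := congr1 (fun F : fps k => F 0%N) cu.
  by rewrite fps_coefM big_ord1 c0 mul1r.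
exists u => e; have e0 : e 0%N = 1 by rewrite fps_coefZ_const u0 scale1r.
have ee : star w gamma e e = e.
  by rewrite starZl starZr II !scalerA -mulrA [u * c]mulrC cu mulr1.
split=> // F; apply/eqP; rewrite -subr_eq0; apply/eqP.
  apply: (star_injl e0); rewrite (linearB (star w gamma e)) /= starA ee.
  exact: subrr.
apply: (star_injr e0); rewrite -[LHS]/(star_rmul e (star w gamma F e - F)).
by rewrite linearB /= /star_rmul -starA ee subrr.
Qed.

End StarBilinear.

(** * The star algebra *)

Section StarSeries.
Variables (k : fieldType) (d : nat).
Implicit Types F G : fps {mpoly k[d]}.

Definition bounded_series : {pred fps {mpoly k[d]}} :=
  fun F => `[< fps_tensor (fun=> True) F >].

Lemma bounded_seriesP F :
  reflect (exists n, forall i, (msize (F i) <= n.+1)%N) (F \in bounded_series).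
Proof. by apply: (iffP (asboolP _)) => /fps_tensorT. Qed.

Fact bounded_series_submod : submod_closed bounded_series.
Proof.
split=> [|c F G /bounded_seriesP[m Fm] /bounded_seriesP[n Gn]].
  by apply/bounded_seriesP; exists 0%N => i; rewrite mmeasure0.
apply/bounded_seriesP; exists (maxn m n) => i; apply/msize_leP => p.
rewrite mcoeffD; have [->|/(msize_leP _ _ (Gn i)) lt_pn _] := eqVneq (G i)@_p 0; last lia.
rewrite addr0 raddf_sum /= => nz.
suff : exists j, (F j)@_p != 0.
  by case=> j /(msize_leP _ _ (Fm j)); lia.
apply: contrapT => /forallNP F0; case/eqP: nz; apply: big1 => j _.
by have /negP/negPn/eqP := F0 (i - j)%N; rewrite mcoeffZ => ->; rewrite mulr0.
Qed.

HB.instance Definition _ :=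
  GRing.isSubmodClosed.Build (fps k) (fps {mpoly k[d]}) bounded_series
    bounded_series_submod.

Record star_series := StarSeries {
  series : fps {mpoly k[d]};
  series_bounded : series \in bounded_series
}.

HB.instance Definition _ := [isSub for series].
HB.instance Definition _ := [Choice of star_series by <:].
HB.instance Definition _ := [SubChoice_isSubLmodule of star_series by <:].

End StarSeries.

Section StarAlgebra.
Variables (k : fieldType) (w : forall n, kgraph n -> k) (d : nat).
Variable gamma : 'M[{mpoly k[d]}]_d.
Hypothesis gamma3 : forall i j, (msize (gamma i j) <= 3)%N.
Implicit Types F G : fps {mpoly k[d]}.

Lemma star_msize m n F G :
  (forall i, msize (F i) <= m.+1)%N -> (forall i, msize (G i) <= n.+1)%N ->
  forall i, (msize (star w gamma F G i) <= (m + n).+1)%N.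
Proof.
move=> Fm Gn i.
have := star_symbol w (quadratic_partP gamma3)
  (F := F) (G := G) (S := fps_map (pihomog mdeg m) F) (T := fps_map (pihomog mdeg n) G)
  (fun i => has_symbol_pihomog (Fm i)) (fun i => has_symbol_pihomog (Gn i)) i.
exact: has_symbol_msize.
Qed.

Lemma star_bounded F G : F \in @bounded_series k d -> G \in @bounded_series k d ->
  star w gamma F G \in @bounded_series k d.
Proof.
move=> /bounded_seriesP[m Fm] /bounded_seriesP[n Gn]; apply/bounded_seriesP.
by exists (m + n)%N; apply: star_msize.
Qed.

(** The carrier is the submodule of series of bounded degree, with the star
    product and its scalar unit. *)
Lemma exists_star_algebra : associative (star w gamma) ->
  exists (A : algType (fps k)) (io : A -> fps {mpoly k[d]}),
    is_star_algebra w gamma io.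
Proof.
move=> starA; have [u] := star_unit starA gamma3.
set e := u *: _ => -[e0 ide1 ide2].
pose T := star_series k d.
have e_bounded : e \in @bounded_series k d.
  apply/bounded_seriesP; exists 0%N => i; rewrite fps_coefZ_const.
  by rewrite (leq_trans (msizeZ_le _ _)) // msize1.
pose one : T := StarSeries e_bounded.
pose mul (x y : T) : T :=
  StarSeries (star_bounded (series_bounded x) (series_bounded y)).
have serI : injective (@series k d) by apply: val_inj.
have mulA : associative mul by move=> x y z; apply: serI; apply: starA.
have mul1 : left_id one mul by move=> x; apply: serI; apply: ide1.
have mulr1 : right_id one mul by move=> x; apply: serI; apply: ide2.
have mulDl : left_distributive mul +%R by move=> x y z; apply: serI; apply: starDl.
have mulDr : right_distributive mul +%R by move=> x y z; apply: serI; apply: starDr.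
have one0 : one != 0.
  apply/eqP => /(congr1 (fun x : T => series x 0%N)) /eqP.
  by rewrite -[series one _]/(e 0%N) e0 oner_eq0.
pose ringT := GRing.Zmodule_isNzRing.Build T mulA mul1 mulr1 mulDl mulDr one0.
pose A1 : nzRingType := HB.pack T ringT.
have scaleAl (c : fps k) (x y : T) : c *: mul x y = mul (c *: x) y.
  by apply: serI; apply/esym/starZl.
have scaleAr (c : fps k) (x y : T) : c *: mul x y = mul x (c *: y).
  by apply: serI; apply/esym/starZr.
pose lalgT := GRing.Lmodule_isLalgebra.Build (fps k) A1 scaleAl.
pose A2 : lalgType (fps k) := HB.pack T ringT lalgT.
pose A : algType (fps k) := HB.pack T ringT lalgT
  (GRing.Lalgebra_isAlgebra.Build (fps k) A2 scaleAr).
exists A, (@series k d); split=> // F; split=> [[a <-]|/asboolP F_bounded].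
  exact/asboolP/(series_bounded a).
by exists (StarSeries F_bounded).
Qed.

End StarAlgebra.

(** * Finite generation *)

Section GenSubalg.
Variables (K : nzRingType) (B : nzRingType) (iota : K -> B) (s : seq B).
Hypotheses (iota0 : iota 0 = 0) (iota1 : iota 1 = 1).

Lemma gen_subalgD x y :
  gen_subalg iota s x -> gen_subalg iota s y -> gen_subalg iota s (x + y).
Proof.
move=> gx gy; rewrite -[y]opprK -[- y]add0r -iota0.
by do !apply: gen_sub => //; apply: gen_scalar.
Qed.

Lemma gen_subalg_sum (I : Type) (r : seq I) (P : pred I) (F : I -> B) :
  (forall i, P i -> gen_subalg iota s (F i)) ->
  gen_subalg iota s (\sum_(i <- r | P i) F i).
Proof.
move=> gF; elim/big_ind: _ => //; last exact: gen_subalgD.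
by rewrite -iota0; apply: gen_scalar.
Qed.

Lemma gen_subalg_prod (I : Type) (r : seq I) (P : pred I) (F : I -> B) :
  (forall i, P i -> gen_subalg iota s (F i)) ->
  gen_subalg iota s (\prod_(i <- r | P i) F i).
Proof.
move=> gF; elim/big_ind: _ => //; last exact: gen_mul.
by rewrite -iota1; apply: gen_scalar.
Qed.

Lemma gen_subalgX x n : gen_subalg iota s x -> gen_subalg iota s (x ^+ n).
Proof.
move=> gx; elim: n => [|n IHn]; last by rewrite exprS; apply: gen_mul.
by rewrite expr0 -iota1; apply: gen_scalar.
Qed.

End GenSubalg.

Section PolyGen.
Variables (k : fieldType) (d : nat).
Implicit Types p q : {mpoly k[d]}.

Lemma mpoly_fingen : exists s : seq {mpoly k[d]}, forall p,
  gen_subalg (fun c : k => c%:A) s p.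
Proof.
have A0 : 0%:A = 0 :> {mpoly k[d]} by rewrite scale0r.
have A1 : 1%:A = 1 :> {mpoly k[d]} by rewrite scale1r.
exists [seq 'X_i | i <- enum 'I_d] => p; rewrite [p]mpolyE.
apply: gen_subalg_sum => // m _; rewrite -mulr_algl.
apply: gen_mul; first exact: gen_scalar.
rewrite mpolyXE_id; apply: gen_subalg_prod => // i _; apply: gen_subalgX => //.
by apply: gen_gen; apply/mapP; exists i; rewrite ?mem_enum.
Qed.

Lemma msizeM_leD m n p q : (msize p <= m.+1)%N -> (msize q <= n.+1)%N ->
  (msize (p * q) <= (m + n).+1)%N.
Proof.
move=> /has_symbol_pihomog pm /has_symbol_pihomog qn.
exact: has_symbol_msize (has_symbolM pm qn).
Qed.

Lemma msize_sum_le n (I : Type) (r : seq I) (P : pred I) (F : I -> {mpoly k[d]}) :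
  (forall i, P i -> msize (F i) <= n)%N -> (msize (\sum_(i <- r | P i) F i) <= n)%N.
Proof.
move=> Fn; elim/big_ind: _ => // [|p q pn qn]; first by rewrite mmeasure0.
by rewrite (leq_trans (msizeD_le _ _)) // geq_max pn.
Qed.

(** The Rees ring of the filtration by the degree is generated by [t] and the
    [x_i t]: a monomial [x^m t^n] with [mdeg m <= n] is the product of the
    [(x_i t)^(m_i)] and of a power of [t]. *)
Lemma rees_fingen : exists s : seq {poly {mpoly k[d]}}, forall p : {poly _},
  gen_subalg (fun c : k => (c%:A)%:P) s p <-> forall n, (msize p`_n <= n.+1)%N.
Proof.
pose Y i : {poly {mpoly k[d]}} := ('X_i)%:P * 'X.
exists ('X :: [seq Y i | i <- enum 'I_d]) => p.
have A0 : (0%:A)%:P = 0 :> {poly {mpoly k[d]}} by rewrite scale0r.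
have A1 : (1%:A)%:P = 1 :> {poly {mpoly k[d]}} by rewrite scale1r.
split=> [|pn].
  elim=> [c|x x_gen|x y _ IHx _ IHy|x y _ IHx _ IHy] n.
  - rewrite coefC; case: n => [|n] /=; last by rewrite mmeasure0.
    by rewrite (leq_trans (msizeZ_le _ _)) ?msize1.
  - move: x_gen; rewrite inE => /predU1P[->|/mapP[i _ ->]].
      by rewrite coefX; case: eqP => _; rewrite ?mmeasure0 ?msize1.
    rewrite coefCM coefX; case: eqP => [->|_]; rewrite ?mulr0 ?mmeasure0 //.
    by rewrite mulr1 msizeX mdeg1.
  - by rewrite coefB (leq_trans (msizeD_le _ _)) // geq_max mmeasureN IHx IHy.
  - rewrite coefM; apply: msize_sum_le => j _.
    by have := msizeM_leD (IHx j) (IHy (n - j)%N); rewrite subnKC // leq_ord.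
rewrite -[p]coefK poly_def; apply: gen_subalg_sum => // n _.
rewrite (mpolywE (pn n)) scaler_suml; apply: gen_subalg_sum => // m _.
rewrite -mul_polyC -mulr_algl polyCM -mulrA.
apply: gen_mul; first exact: gen_scalar.
have le_mn : (mdeg m <= n)%N by rewrite -ltnS bmdeg.
have -> : 'X_[m]%:P * 'X^n = (\prod_(i < d) Y i ^+ m i) * 'X^(n - mdeg m).
  have -> : 'X^n = 'X^(mdeg m) * 'X^(n - mdeg m) :> {poly {mpoly k[d]}}.
    by rewrite -exprD subnKC.
  rewrite mulrA; congr (_ * _).
  rewrite (eq_bigr (fun i => ('X_i ^+ m i)%:P * 'X^(m i))) => [|i _]; last first.
    by rewrite exprMn polyC_exp.
  by rewrite big_split prodrXr -rmorph_prod -mpolyXE_id mdegE.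
apply: gen_mul; last by apply/gen_subalgX/gen_gen; rewrite ?inE ?eqxx.
apply: gen_subalg_prod => // i _; apply: gen_subalgX => //.
by apply: gen_gen; apply/orP; right; apply/mapP; exists i; rewrite ?mem_enum.
Qed.

End PolyGen.

(** * The deformation and its associated graded algebra *)

Section Deformation.
Variables (k : fieldType) (w : forall n, kgraph n -> k) (d : nat).
Variable gamma : 'M[{mpoly k[d]}]_d.
Hypothesis starA : associative (star w gamma).
Hypothesis gamma3 : forall i j, (msize (gamma i j) <= 3)%N.
Variables (A : algType (fps k)) (io : A -> fps {mpoly k[d]}).
Hypothesis ioP : is_star_algebra w gamma io.

HB.instance Definition _ :=
  GRing.isLinear.Build (fps k) A (fps {mpoly k[d]}) *:%R io (star_alg_linear ioP).

Let io_inj : injective io := star_alg_inj ioP.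
Let ioM a b : io (a * b) = star w gamma (io a) (io b) := star_alg_mul ioP a b.

Let ioZ c a : io (c *: a) = c *: io a.
Proof. exact: linearZZ. Qed.

Definition star_filtration n (a : A) : Prop :=
  fps_tensor (fun p : {mpoly k[d]} => is_true (msize p <= n.+1)%N) (io a).

Lemma star_filtrationP n a :
  star_filtration n a <-> forall i, (msize (io a i) <= n.+1)%N.
Proof. exact: fps_tensor_le. Qed.

Lemma io_exists n (F : fps {mpoly k[d]}) : (forall i, msize (F i) <= n.+1)%N -> exists a, io a = F.
Proof. by move=> Fn; apply/(star_alg_image ioP)/fps_tensorT; exists n. Qed.

Lemma io_filtered a : exists n, star_filtration n a.
Proof.
have /fps_tensorT[n an] : fps_tensor (fun=> True) (io a).
  by apply/(star_alg_image ioP); exists a.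
by exists n; apply/star_filtrationP.
Qed.

(** By uniqueness of the unit, it is the scalar one. *)
Lemma io_unit : exists u : fps k, u 0%N = 1 /\ io 1 = u *: fps_const 1.
Proof.
have [u [e0 ide1 ide2]] := star_unit starA gamma3; exists u; split.
  move: e0; rewrite fps_coefZ_const => /(congr1 (mcoeff 0)).
  by rewrite mcoeffZ mcoeff1 eqxx mulr1.
have [|a ioa] := @io_exists 0%N (u *: fps_const (1 : {mpoly k[d]})).
  by move=> i; rewrite fps_coefZ_const (leq_trans (msizeZ_le _ _)) ?msize1.
by rewrite -ioa -[in RHS](mulr1 a) ioM ioa ide1.
Qed.

Definition star_residue (a : A) : {mpoly k[d]} := io a 0%N.

Fact star_residue_linear :
  linear_for ((@fps_residue k : {rmorphism fps k -> k}) \; *:%R) star_residue.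
Proof.
move=> c a b; rewrite /star_residue linearP.
by rewrite -[LHS]/((c *: io a) 0%N + io b 0%N) fps_coefZ big_ord1.
Qed.

Fact star_residue_monoid : monoid_morphism star_residue.
Proof.
split=> [|a b]; last by rewrite /star_residue ioM star_coef0.
by have [u [u0 io1]] := io_unit; rewrite /star_residue io1 fps_coefZ_const u0 scale1r.
Qed.

HB.instance Definition _ := GRing.isLinear.Build (fps k) A {mpoly k[d]} _
  star_residue star_residue_linear.
HB.instance Definition _ := GRing.isMonoidMorphism.Build A {mpoly k[d]}
  star_residue star_residue_monoid.

(** A series without constant term is [h] times its shift, which is again of
    bounded degree. *)
Lemma star_residue_ker x : star_residue x = 0 <->
  exists (m : nat) (r : 'I_m -> fps k) (y : 'I_m -> A),
    (forall i, fps_residue (r i) = 0) /\ x = \sum_i r i *: y i.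
Proof.
split=> [x0|[m [r [y [r0 ->]]]]]; last first.
  rewrite linear_sum big1 // => i _.
  by rewrite linearZ /= r0 scale0r.
pose hbar : fps k := Fps (fun n => (n == 1%N)%:R).
have [n /star_filtrationP xn] := io_filtered x.
have [|y ioy] := @io_exists n (Fps (fun i => io x i.+1)); first by move=> i; apply: xn.
exists 1%N, (fun=> hbar), (fun=> y); split=> //.
apply: io_inj; rewrite big_ord1 ioZ ioy; apply: fpsP => -[|i].
  by rewrite [RHS]fps_coefZ big_ord1 scale0r -[LHS]/(star_residue x) x0.
rewrite [RHS]fps_coefZ !big_ord_recl big1 => [|j _]; last by rewrite scale0r.
by rewrite scale0r add0r scale1r addr0 /= subn1.
Qed.

(** The constant series at the monomials of degree at most [n] form a basis. *)
Lemma star_filtration_free n : free_finite_rank (star_filtration n).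
Proof.
pose X m : {mpoly k[d]} := 'X_[m].
have /choice[b bE] : forall m : 'X_{1..d < n.+1}, exists a, io a = fps_const (X m).
  move=> m; apply: (@io_exists n) => -[|i] /=; rewrite ?mmeasure0 //.
  by rewrite msizeX bmdeg.
pose e (j : 'I_#|{: 'X_{1..d < n.+1}}|) : 'X_{1..d < n.+1} := enum_val j.
have eK : bijective e by apply: enum_val_bij.
have ioE (c : 'X_{1..d < n.+1} -> fps k) i :
    io (\sum_j c (e j) *: b (e j)) i = \sum_m c m i *: X m.
  rewrite linear_sum fps_coef_sum [RHS](reindex e) /=; last exact: onW_bij.
  by apply: eq_bigr => j _; rewrite ioZ bE fps_coefZ_const.
have [e' eK1 eK2] := eK.
have cE (c : 'I_#|{: 'X_{1..d < n.+1}}| -> fps k) :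
    \sum_j c j *: b (e j) = \sum_j (c \o e') (e j) *: b (e j).
  by apply: eq_bigr => j _; rewrite /= eK1.
exists #|{: 'X_{1..d < n.+1}}|, (b \o e); split=> [x|c c0 j]; last first.
  rewrite cE in c0; apply: fpsP => i.
  have := congr1 (fun a => (io a i)@_(e j)) c0; rewrite ioE linear0 /=.
  (* [mcoeff_mpoly] wants coefficients defined at all monomials. *)
  pose E m := if insub m is Some m' then (c (e' m') i) else 0.
  rewrite (eq_bigr (fun m : 'X_{1..d < n.+1} => E m *: X m)) => [|m _].
    by rewrite mcoeff_mpoly ?bmdeg // /E valK eK1 mcoeff0.
  by rewrite /E valK.
split=> [/star_filtrationP xn|[c ->]].
  exists (fun j => Fps (fun i => (io x i)@_(e j))); apply: io_inj; apply: fpsP => i.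
  by rewrite (ioE (fun m => Fps (fun i => (io x i)@_m))) {1}(mpolywE (xn i)).
apply/star_filtrationP => i; rewrite cE ioE; apply: msize_sum_le => m _.
by rewrite (leq_trans (msizeZ_le _ _)) // msizeX bmdeg.
Qed.

Lemma homog_le m n (p : {mpoly k[d]}) : (m <= n)%N -> p \is m.-homog ->
  (msize p <= n.+1)%N.
Proof. by move=> le_mn /homog_has_symbol/has_symbol_msize; lia. Qed.

(** The grading of the symmetric algebra splits the filtration. *)
Lemma star_filtration_splits :
  exists G, splits_filtration star_filtration G.
Proof.
pose S n : {mpoly k[d]} -> Prop := fun p => is_true (p \is n.-homog).
exists (fun n a => forall i, io a i \is n.-homog); split=> n.
  split=> [|c x y xn yn] i; first by rewrite linear0; apply: dhomog0.
  rewrite linearP fps_coefD fps_coefZ; apply: rpredD => //.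
  by apply: rpred_sum => j _; apply: rpredZ.
have ioE (g : 'I_n.+1 -> A) i : io (\sum_j g j) i = \sum_j io (g j) i.
  by rewrite linear_sum fps_coef_sum.
split=> [x|g gn g0 i].
  split=> [/star_filtrationP xn|[g [gn ->]]].
    have /choice[g gE] : forall j : 'I_n.+1, exists a,
        io a = fps_map (pihomog mdeg j) (io x).
      move=> j; apply: (@io_exists n) => i /=.
      by apply: (@homog_le j); [rewrite -ltnS | apply: pihomogP].
    exists g; split=> [j i|]; first by rewrite gE; apply: pihomogP.
    apply/io_inj/fpsP => i; rewrite ioE {1}(pihomog_partitionE (xn i)).
    by apply: eq_bigr => j _; rewrite gE.
  apply/star_filtrationP => i; rewrite ioE; apply: msize_sum_le => j _.
  by apply: (@homog_le j); [rewrite -ltnS | apply: gn].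
apply/io_inj/fpsP => N; rewrite linear0.
have := congr1 (fun a => pihomog mdeg i (io a N)) g0.
rewrite ioE linear0 !linear_sum (bigD1 i) //= pihomog_dE ?gn // big1 ?addr0.
  by move=> ->; rewrite linear0.
by move=> j ne_ji; apply: pihomog_ne0 (gn j N).
Qed.

Lemma star_deformation :
  exists pi : {lrmorphism A -> {mpoly k[d]}
                | (@fps_residue k : {rmorphism fps k -> k}) \; *:%R},
    (forall a, pi a = io a 0%N) /\ semiformal_deformation pi star_filtration.
Proof.
exists star_residue; split=> //; split.
- exact: fps_complete_pro_artin.
- exact: mpoly_fingen.
- move=> p; have [|a ioa] := @io_exists (msize p) (fps_const p).
    by case=> [|i] /=; rewrite ?mmeasure0 ?leqnSn.
  by exists a; rewrite /= /star_residue ioa.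
- exact: star_residue_ker.
- move=> n x /star_filtrationP xn; apply/star_filtrationP => i.
  exact: leqW.
- exact: io_filtered.
- exact: star_filtration_free.
- have [u [_ io1]] := io_unit; apply/star_filtrationP => i.
  by rewrite io1 fps_coefZ_const (leq_trans (msizeZ_le _ _)) ?msize1.
- move=> m n x y /star_filtrationP xm /star_filtrationP yn; apply/star_filtrationP.
  by rewrite ioM; apply: star_msize.
- exact: star_filtration_splits.
- have [s sP] := @rees_fingen k d; exists s => p; rewrite sP.
  split=> [pn n|px n]; last first.
    by have [x /star_filtrationP xn <-] := px n; apply: xn.
  have [|a ioa] := @io_exists n (fps_const p`_n).
    by case=> [|i] /=; rewrite ?mmeasure0.
  exists a; last by rewrite /= /star_residue ioa.
  by apply/star_filtrationP; rewrite ioa => -[|i] /=; rewrite ?mmeasure0.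
Qed.

End Deformation.

Section AssociatedGraded.
Variables (k : fieldType) (w : forall n, kgraph n -> k) (d : nat).
Variable gamma : 'M[{mpoly k[d]}]_d.
Hypothesis gamma3 : forall i j, (msize (gamma i j) <= 3)%N.
Let gamma2 := quadratic_part gamma.
Hypothesis starA : associative (star w gamma).
Variables (A A2 : algType (fps k)).
Variables (io : A -> fps {mpoly k[d]}) (io2 : A2 -> fps {mpoly k[d]}).
Hypothesis ioP : is_star_algebra w gamma io.
Hypothesis io2P : is_star_algebra w gamma2 io2.

Lemma pihomog_eq0 n (p : {mpoly k[d]}) : (msize p <= n.+1)%N ->
  (pihomog mdeg n p == 0) = (msize p <= n)%N.
Proof.
move=> pn; apply/eqP/msize_leP => [p0 m pm|p0].
  have := msize_leP _ _ pn m pm; rewrite ltnS leq_eqVlt => /predU1P[mn|//].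
  by have /eqP := congr1 (mcoeff m) p0; rewrite mcoeff_pihomog mn eqxx mcoeff0 (negPf pm).
apply/mpolyP => m; rewrite mcoeff_pihomog mcoeff0; case: eqP => // mn.
by apply/eqP; apply: contraTT isT => /p0; rewrite mn ltnn.
Qed.

HB.instance Definition _ :=
  GRing.isLinear.Build (fps k) A (fps {mpoly k[d]}) *:%R io (star_alg_linear ioP).
HB.instance Definition _ :=
  GRing.isLinear.Build (fps k) A2 (fps {mpoly k[d]}) *:%R io2 (star_alg_linear io2P).

Fact fps_map_linear n : linear (fps_map (@pihomog d k mdeg n)).
Proof.
move=> c F G; apply: fpsP => i.
rewrite [LHS]linearD; congr (_ + _); rewrite [LHS]linear_sum fps_coefZ.
by apply: eq_bigr => j _; rewrite linearZ.
Qed.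

(** Taking top degree parts is multiplicative from the star product of [gamma]
    to that of its quadratic part, since each term of the former has as symbol
    the corresponding term of the latter. *)
Lemma star_associated_graded :
  exists sigma : nat -> A -> A2,
    (forall n a, io2 (sigma n a) = fps_map (pihomog mdeg n) (io a)) /\
    is_associated_graded (star_filtration io) sigma.
Proof.
have sigma_ex n a : exists b, io2 b = fps_map (pihomog mdeg n) (io a).
  apply: (io_exists io2P (n := n)) => i.
  by apply: (@homog_le _ _ n) => //; apply: pihomogP.
have [sigma sigmaE] : exists sigma : nat -> A -> A2,
    forall n a, io2 (sigma n a) = fps_map (pihomog mdeg n) (io a).
  by exists (fun n => projT1 (choice (sigma_ex n))) => n;
    exact: (projT2 (choice (sigma_ex n))).
have io2_inj := star_alg_inj io2P.
have io2_sum N (f : 'I_N -> A2) : io2 (\sum_j f j) = \sum_j io2 (f j).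
  exact: linear_sum.
have sigmaM m n x y : star_filtration io m x -> star_filtration io n y ->
    sigma (m + n)%N (x * y) = sigma m x * sigma n y.
  move=> /star_filtrationP xm /star_filtrationP yn.
  apply/io2_inj/fpsP => i; rewrite (star_alg_mul io2P) !sigmaE (star_alg_mul ioP).
  apply/esym/has_symbolE; rewrite PoszD.
  apply: (star_symbol _ (quadratic_partP gamma3)) => j /=.
    exact: has_symbol_pihomog.
  exact: has_symbol_pihomog.
exists sigma; split=> //; split=> //.
- move=> n c x y _ _; apply: io2_inj; rewrite (star_alg_linear io2P) !sigmaE.
  by rewrite (star_alg_linear ioP); apply: fps_map_linear.
- move=> n x /star_filtrationP xn; split=> [s0|].
    have xn' i : (msize (io x i) <= n)%N.
      rewrite -(pihomog_eq0 (xn i)).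
      by have := congr1 (fun a => io2 a i) s0; rewrite sigmaE linear0 /= => ->.
    case: n {xn s0} xn' => [|m] xm; last exact/star_filtrationP.
    apply/(star_alg_inj ioP)/fpsP => i; rewrite linear0.
    by apply/eqP; rewrite -msize_poly_eq0 -leqn0.
  move=> xm; apply/io2_inj/fpsP => i; rewrite linear0 sigmaE; apply/eqP.
  rewrite [fps_map _ _ _]/= pihomog_eq0 //; case: n xm {xn} => [->|m].
    by rewrite linear0 mmeasure0.
  by move=> /star_filtrationP.
- move=> b; have [n /star_filtrationP bn] := io_filtered io2P b.
  have x_ex j : exists a, io a = fps_map (pihomog mdeg j) (io2 b).
    apply: (io_exists ioP (n := j)) => i.
    by apply: (@homog_le _ _ j) => //; apply: pihomogP.
  have /choice[x xE] := x_ex; exists n.+1, x; split=> [j|].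
    apply/star_filtrationP => i; rewrite xE.
    by apply: (@homog_le _ _ j) => //; apply: pihomogP.
  apply/io2_inj/fpsP => i; rewrite io2_sum fps_coef_sum.
  rewrite [LHS](pihomog_partitionE (bn i)); apply: eq_bigr => j _.
  by rewrite sigmaE xE /= pihomog_id.
- move=> N x _ s0 n lt_nN; apply/io2_inj/fpsP => i; rewrite linear0.
  have := congr1 (fun a => pihomog mdeg n (io2 a i)) s0.
  rewrite linear0 io2_sum fps_coef_sum !linear_sum (bigD1 (Ordinal lt_nN)) //=.
  rewrite big1 => [|j ne_jn]; last first.
    rewrite sigmaE; apply: pihomog_ne0 (pihomogP _ _ _).
    by apply: contraNneq ne_jn => ?; apply/eqP/val_inj.
  by rewrite sigmaE /= pihomog_id addr0 => ->; rewrite linear0.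
- (* It is idempotent, and equal to 1 modulo h. *)
  have [u [u0 io1]] := io_unit starA gamma3 ioP.
  have F01 : star_filtration io 0 1.
    apply/star_filtrationP => i.
    by rewrite io1 fps_coefZ_const (leq_trans (msizeZ_le _ _)) ?msize1.
  have s1 : sigma 0%N 1 * sigma 0%N 1 = sigma 0%N 1.
    by rewrite -(sigmaM 0%N 0%N) // mulr1.
  apply/eqP; rewrite -subr_eq0; apply/eqP/io2_inj; rewrite linear0.
  apply: (star_injl (w := w) (gamma := gamma2) (F := io2 (sigma 0%N 1))).
    rewrite sigmaE io1 /= big_ord1 u0 scale1r pihomog_dE //.
    exact: dhomog1.
  by rewrite -(star_alg_mul io2P) mulrBr mulr1 s1 subrr linear0.
Qed.

End AssociatedGraded.

Theorem mainTheorem5 (k : fieldType) (char0 : [pchar k] =i pred0)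
    (w : forall n, kgraph n -> k) (hw : universal_star_weights w)
    (d : nat) (gamma : 'M[{mpoly k[d]}]_d) (hP : is_poisson gamma)
    (hdeg : forall i j, (msize (gamma i j) <= 3)%N) :
  let gamma2 := quadratic_part gamma in
  let Sym_le n (p : {mpoly k[d]}) := is_true (msize p <= n.+1)%N in
  let Sym n (p : {mpoly k[d]}) := is_true (p \is n.-homog) in
  let A_gamma := fps_tensor (fun _ : {mpoly k[d]} => True) in
  [/\
    forall (F : fps {mpoly k[d]}) N, exists2 G, A_gamma G & forall n, (n < N)%N -> G n = F n,
    forall F G, A_gamma F -> A_gamma G -> A_gamma (star w gamma F G),
    is_poisson gamma2,
    exists (A A2 : algType (fps k))
        (io : A -> fps {mpoly k[d]}) (io2 : A2 -> fps {mpoly k[d]}),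
      [/\ is_star_algebra w gamma io,
          is_star_algebra w gamma2 io2
        & let Fil n a := fps_tensor (Sym_le n) (io a) in
          (exists pi : {lrmorphism A -> {mpoly k[d]}
                         | (@fps_residue k : {rmorphism fps k -> k}) \; *:%R},
             (forall a, pi a = io a 0%N) /\
             semiformal_deformation pi Fil) /\
          (exists sigma : nat -> A -> A2,
             (forall n a, io2 (sigma n a) = fps_map (pihomog mdeg n) (io a)) /\
             is_associated_graded Fil sigma)]
  & (forall i j, gamma i j \is 2.-homog) ->
    forall m n f g, Sym m f -> Sym n g ->
      fps_tensor (Sym (m + n)%N) (star w gamma (fps_const f) (fps_const g))].
Proof.
move=> gamma2 Sym_le Sym A_gamma.
have gammaP := quadratic_partP hdeg; rewrite -/gamma2 in gammaP.
have hP2 : is_poisson gamma2 := poisson_symbol gammaP hP.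
have [[starA _] [starA2 _]] := (hw _ _ hP, hw _ _ hP2).
have gamma23 i j : (msize (gamma2 i j) <= 3)%N.
  by rewrite mxE; apply: (@homog_le _ _ 2%N) => //; apply: pihomogP.
split=> //.
- move=> F N; exists (Fps (fun n => if (n < N)%N then F n else 0)) => [|n /= ->//].
  apply/fps_tensorT; exists (\max_(n < N) msize (F n)) => i /=.
  case: ifP => [lt_iN|_]; last by rewrite mmeasure0.
  exact/leqW/(leq_bigmax (F := fun n : 'I_N => msize (F n)) (Ordinal lt_iN)).
- by move=> F G AF AG; apply/asboolP/(star_bounded w hdeg); apply/asboolP.
- have [A [io ioP]] := exists_star_algebra hdeg starA.
  have [A2 [io2 io2P]] := exists_star_algebra gamma23 starA2.
  exists A, A2, io, io2; split=> // Fil; split.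
    exact (star_deformation starA hdeg ioP).
  exact (star_associated_graded hdeg starA ioP io2P).
move=> gamma_homog m n f g fm gn; apply/fps_tensor_homog => i.
have gammaPP : quadratic_symbol gamma gamma.
  by move=> p q; apply: homog_has_symbol.
apply: (@has_symbol_homog _ _ _ (star w gamma (fps_const f) (fps_const g) i)).
rewrite PoszD; apply: (star_symbol _ gammaPP) => -[|j]; try exact: has_symbol0.
  exact: homog_has_symbol.
exact: homog_has_symbol.
Qed.
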